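(* Let $G$ be an infinite, connected, locally finite simplicial graph with vertex set $V$. Then the combinatorial Laplacian $\Delta_G \colon \mathbb{R}^V \to \mathbb{R}^V$ is surjective.
   Context: A simplicial graph is an undirected graph without loops and multiple edges. Two vertices $v,w \in V$ are called adjacent, written $v \sim w$, if $\{v,w\}$ is an edge of $G$. The degree $\deg(v)$ of a vertex $v$ is the number of vertices of $G$ adjacent to $v$; the graph is locally finite if every vertex has finite degree. $\mathbb{R}^V$ denotes the real vector space of all functions $f \colon V \to \mathbb{R}$. The combinatorial Laplacian on $G$ is the linear map $\Delta_G \colon \mathbb{R}^V \to \mathbb{R}^V$ defined by $$\Delta_G(f)(v) = f(v) - \frac{1}{\deg(v)} \sum_{v \sim w} f(w)$$ for all $f \in \mathbb{R}^V$ and $v \in V$, where the sum is over all vertices $w$ adjacent to $v$. *)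

(* Defs.v *)
From HB Require Import structures.
From mathcomp Require Import all_boot all_order all_algebra.
From mathcomp Require Import finmap.
From mathcomp Require Import all_classical reals.

Set Implicit Arguments.
Unset Strict Implicit.
Unset Printing Implicit Defensive.

Import Order.TTheory GRing.Theory Num.Theory.

Local Open Scope classical_set_scope.
Local Open Scope ring_scope.

Record simplicial_graph (V : Type) := SimplicialGraph {
  adj : rel V;
  adj_sym : symmetric adj;
  adj_irr : irreflexive adj }.

Definition neighbors (V : Type) (G : simplicial_graph V) (v : V) : set V :=
  [set w | adj G v w].

Definition locally_finite (V : Type) (G : simplicial_graph V) : Prop :=
  forall v, finite_set (neighbors G v).

Definition connected_graph (V : Type) (G : simplicial_graph V) : Prop :=
  forall v w, exists2 p : seq V, path (adj G) v p & last v p = w.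

(* [fset_set A] is the finite set with the same elements as [A] when [A] is
   finite, and is empty otherwise: [degree] and [laplacian] are meaningful only
   at vertices with finitely many neighbors. *)
Definition degree (V : choiceType) (G : simplicial_graph V) (v : V) : nat :=
  #|` fset_set (neighbors G v)|.

Definition laplacian (R : realType) (V : choiceType) (G : simplicial_graph V)
    (f : V -> R) : V -> R :=
  fun v => f v - (degree G v)%:R^-1 * \sum_(w <- fset_set (neighbors G v)) f w.

Lemma laplacian_is_linear (R : realType) (V : choiceType)
    (G : simplicial_graph V) :
  linear (laplacian G : (V -> R^o) -> (V -> R^o)).
Proof.
move=> a f g; apply/funext => v; rewrite /laplacian !fctE big_split /=.
have -> : \sum_(w <- fset_set (neighbors G v)) a *: f w =
    a * \sum_(w <- fset_set (neighbors G v)) f w by rewrite mulr_sumr.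
rewrite /GRing.scale /=.
by rewrite mulrDr mulrCA mulrBr opprD addrACA.
Qed.

HB.instance Definition _ (R : realType) (V : choiceType)
    (G : simplicial_graph V) :=
  GRing.isLinear.Build R (V -> R^o) (V -> R^o) _ (@laplacian R V G)
    (@laplacian_is_linear R V G).

(* Main.v *)
(* By the maximum principle, a finitely supported function that is harmonic on
   its support vanishes, because an infinite connected graph has vertices
   outside any finite set. So for finite [A] the Laplacian on functions
   supported in [A], restricted to [A], is an injective endomorphism of a
   finite-dimensional space, hence onto: every finite subsystem of the equations
   [laplacian f = g] is solvable. Each equation involves finitely many unknowns
   and there are countably many of them, so the values of [f] can be fixed one
   vertex at a time, keeping every finite subsystem solvable. *)
Require Import Defs.
From HB Require Import structures.
From mathcomp Require Import all_boot all_order all_algebra.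
From mathcomp Require Import finmap.
From mathcomp Require Import all_classical reals.

Local Open Scope classical_set_scope.
Local Open Scope ring_scope.

Import Order.TTheory GRing.Theory Num.Theory.

Section Laplacian.
Variables (R : realType) (V : choiceType) (G : simplicial_graph V).
Hypothesis G_infinite : infinite_set [set: V].
Hypothesis G_connected : connected_graph G.
Hypothesis G_locally_finite : locally_finite G.
Implicit Types (f g h : V -> R) (A B : {fset V}) (v w : V).

Lemma mem_neighbors v w : (w \in fset_set (neighbors G v)) = adj G v w.
Proof.
rewrite in_fset_set; last exact: G_locally_finite.
by apply/idP/idP; rewrite inE.
Qed.

Lemma laplacianP (a : R) f h v :
  laplacian G (fun w => a * f w + h w) v = a * laplacian G f v + laplacian G h v.
Proof. exact: (congr1 (fun k => k v) (@laplacian_is_linear R V G a f h)). Qed.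

Lemma eq_laplacian f h v :
  f v = h v -> {in neighbors G v, f =1 h} -> laplacian G f v = laplacian G h v.
Proof.
move=> fhv fh; rewrite /laplacian fhv; congr (_ - _ * _).
apply: eq_big_seq => w; rewrite mem_neighbors => vw.
by apply: fh; rewrite inE.
Qed.

Lemma adj_closed_full (S : set V) v :
  S v -> (forall u w, S u -> adj G u w -> S w) -> forall w, S w.
Proof.
move=> Sv Sadj w; have [p + <-] := G_connected v w.
elim: p v Sv => [//|u p IHp] v Sv /= /andP[vu pp].
exact: IHp (Sadj _ _ Sv vu) pp.
Qed.

(** Here [ball n] collects the endpoints of walks of length exactly [n] from [v]: each is finite by
    local finiteness, and their union is everything by connectedness. *)
Lemma connected_locally_finite_countable : countable [set: V].
Proof.
have [v _] := infinite_setN0 G_infinite.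
pose ball := fix ball n :=
  if n is m.+1 then \bigcup_(u in ball m) neighbors G u else [set v].
have ball_fin n : finite_set (ball n).
  elim: n => [|n IHn] /=; first exact: finite_set1.
  by apply: bigcup_finite => // u _; exact: G_locally_finite.
apply: (@sub_countable _ _ _ (\bigcup_n ball n)); last first.
  apply: bigcup_countable => // n _; exact: finite_set_countable.
apply: subset_card_le => w _.
apply: (@adj_closed_full (\bigcup_n ball n) v); first by exists 0%N.
by move=> x y [n _ xn] xy; exists n.+1 => //; exists x.
Qed.

Lemma harmonic_max_neighbors h v :
  laplacian G h v = 0 -> 0 < h v -> (forall w, h w <= h v) ->
  forall w, adj G v w -> h w = h v.
Proof.
rewrite /laplacian => lap0 hv_gt0 h_le w vw.
(* In degree 0 the convention [0^-1 = 0] would give [laplacian G h v = h v], which is positive. *)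
have deg_neq0 : (degree G v)%:R != 0 :> R.
  apply/eqP => deg0; move: lap0 hv_gt0.
  by rewrite deg0 invr0 mul0r subr0 => ->; rewrite ltxx.
have: \sum_(u <- fset_set (neighbors G v)) (h v - h u) = 0.
  move/eqP: lap0; rewrite subr_eq0 => /eqP lap0.
  rewrite sumrB big_const_seq count_predT iter_addr_0.
  by rewrite -mulr_natl {1}lap0 mulVKf // subrr.
move/eqP; rewrite psumr_eq0 => [/allP/(_ w)|u _]; last by rewrite subr_ge0.
by rewrite mem_neighbors => /(_ vw) /=; rewrite subr_eq0 => /eqP.
Qed.

(** A positive value would yield a positive maximum, attained in [A]; it spreads along edges to
    every vertex, so the finite set [A] would contain all of [V]. *)
Lemma harmonic_finite_support_le0 A h :
  (forall v, v \notin A -> h v = 0) -> (forall v, v \in A -> laplacian G h v = 0) ->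
  forall v, h v <= 0.
Proof.
move=> h0 lap0 v0; rewrite leNgt; apply/negP => hv0_gt0.
have inA v : 0 < h v -> v \in A.
  by apply: contraTT => /h0 ->; rewrite ltxx.
pose a0 : A := [` inA _ hv0_gt0]%fset.
have [a _ amax] := @arg_maxP _ _ A a0 xpredT (h \o val) isT.
have ha_gt0 : 0 < h (val a) by apply: lt_le_trans hv0_gt0 (amax a0 isT).
have h_le w : h w <= h (val a).
  have [wA|/h0 ->] := boolP (w \in A); last exact: ltW.
  exact: (amax [` wA]%fset isT).
have h_const : forall w, h w = h (val a).
  apply: (@adj_closed_full [set w | h w = h (val a)] (val a)) => //= u w hu uw.
  rewrite -hu; apply: (harmonic_max_neighbors h u) => //; rewrite ?hu //.
  by rewrite lap0 // inA // hu.
apply: G_infinite; apply: (@sub_finite_set _ _ [set` A]) => // w _ /=.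
by rewrite (inA w) // h_const.
Qed.

Lemma harmonic_finite_support_eq0 A h :
  (forall v, v \notin A -> h v = 0) -> (forall v, v \in A -> laplacian G h v = 0) ->
  forall v, h v = 0.
Proof.
move=> h0 lap0 v; apply/eqP; rewrite eq_le.
rewrite (harmonic_finite_support_le0 A) //= -oppr_le0.
have oppE : (fun w => - h w) = (fun w => -1 * h w + 0).
  by apply/funext => w; rewrite mulN1r addr0.
apply: (harmonic_finite_support_le0 A (fun w => - h w)) => w wA.
  by rewrite h0 ?oppr0.
rewrite oppE laplacianP lap0 // mulr0 add0r /laplacian.
by rewrite big1 // mulr0 subr0.
Qed.

Lemma laplacian_surj_finite A g :
  exists h, forall v, v \in A -> laplacian G h v = g v.
Proof.
(* Extension by zero outside [A], which makes [phi] the Laplacian on [A] with Dirichlet boundary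
   condition. *)
pose ext (u : {ffun A -> R^o}) v : R := if insub v is Some a then u a else 0.
pose phi (u : {ffun A -> R^o}) : {ffun A -> R^o} :=
  [ffun a => laplacian G (ext u) (val a)].
have phi_lin : linear phi.
  move=> c u w; apply/ffunP => a; rewrite !ffunE -laplacianP; congr laplacian.
  apply/funext => v; rewrite /ext; case: insubP => [b _ _|_].
    by rewrite !ffunE.
  by rewrite mulr0 addr0.
pose phiL := GRing.isLinear.Build _ _ _ _ phi phi_lin.
pose Phi : {linear {ffun A -> R^o} -> {ffun A -> R^o}} := HB.pack phi phiL.
have ker0 : lker (linfun Phi) == 0%VS.
  rewrite -subv0; apply/subvP => u; rewrite memv_ker memv0 lfunE /= => /eqP u0.
  apply/eqP/ffunP => a; rewrite ffunE.
  have -> : u a = ext u (val a) by rewrite /ext valK.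
  apply: (harmonic_finite_support_eq0 A) => v vA.
    by rewrite /ext insubN.
  by have /ffunP/(_ [` vA]%fset) := u0; rewrite !ffunE.
have := lker0_lfunVK ker0 [ffun a => g (val a)]; rewrite lfunE /= => phiE.
exists (ext ((linfun Phi)^-1%VF [ffun a => g (val a)])) => v vA.
by have /ffunP/(_ [` vA]%fset) := phiE; rewrite !ffunE.
Qed.

(* Linear compactness: for a fixed [v], the sets of values at [v] of solutions
   of finite subsystems are nonempty affine subspaces of the line directed by
   inclusion; if one of them is a point, it is common to all, and otherwise
   they are all the whole line. *)
Lemma extend_finitely_solvable (S : set V) f g v :
  (forall A, exists2 h, {in S, h =1 f} &
    {in A, laplacian G h =1 g}) ->
  exists c, forall A, exists h, [/\ {in S, h =1 f}, h v = c &
    {in A, laplacian G h =1 g}].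
Proof.
move=> solv.
pose sol A h := {in S, h =1 f} /\ {in A, laplacian G h =1 g}.
have [[A A_rigid]|flex] :=
  pselect (exists A, forall h h', sol A h -> sol A h' -> h v = h' v).
  (* A solution for the union of [A] and [B] also solves for [A], so rigidity forces its value at
     [v]. *)
  have [h0 h0S h0A] := solv A; exists (h0 v) => B.
  have [h hS hAB] := solv (A `|` B)%fset; exists h; split => //; last first.
    by move=> w wB; apply: hAB; rewrite in_fsetU wB orbT.
  apply: A_rigid; split => // w wA.
  by apply: hAB; rewrite in_fsetU wA.
(* Every value can be reached at [v] here; 0 is an arbitrary choice. *)
exists 0 => A.
have [h [h' [[hS hA] [h'S h'A] hh']]] :
    exists h h', [/\ sol A h, sol A h' & h v != h' v].
  apply: contrapT => no; apply: flex; exists A => h h' sh sh'.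
  by apply: contrapT => /eqP ne; apply: no; exists h, h'.
have dv : h v - h' v != 0 by rewrite subr_eq0.
(* The parameter at which the affine line [h + t (h - h')] of solutions vanishes at [v]. *)
pose t := - h v / (h v - h' v).
pose k w := t * (-1 * h' w + h w) + h w.
exists k; split => [w wS||w wA].
- by rewrite /k hS // h'S // mulN1r addNr mulr0 add0r.
- by rewrite /k /t mulN1r (addrC (- _)) mulfVK // addNr.
- by rewrite /k !laplacianP hA // h'A // mulN1r addNr mulr0 add0r.
Qed.

Lemma laplacian_surj g : exists f, laplacian G f = g.
Proof.
have /countable_injP[e e_inj] := connected_locally_finite_countable.
pose below n := [set v | (e v < n)%N].
pose P n f := forall A, exists2 h, {in below n, h =1 f} & {in A, laplacian G h =1 g}.
(* The hypothesis [P] sits under the existential so that [choice] yields a total function on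
   pairs. *)
have step nf : exists f',
    P nf.1 nf.2 -> {in below nf.1, f' =1 nf.2} /\ P nf.1.+1 f'.
  case: nf => n f /=; have [Pf|nPf] := pselect (P n f); last by exists f.
  (* The code [e] is only injective: if no vertex has code [n], there is no value to fix. *)
  have [[v ev]|nov] := pselect (exists v, e v = n); last first.
    exists f => _; split => // A; have [h hf hA] := Pf A; exists h => // w.
    rewrite inE /below /= ltnS leq_eqVlt => /orP[/eqP ew|wn].
      by case: nov; exists w.
    by apply: hf; rewrite inE.
  have [c Hc] := extend_finitely_solvable _ _ _ v Pf.
  exists (fun w => if w == v then c else f w) => _; split.
    by move=> w; rewrite inE /below /=; case: eqP => // ->; rewrite ev ltnn.
  move=> A; have [h [hf hv hA]] := Hc A; exists h => // w.
  rewrite inE /below /= ltnS leq_eqVlt; case: (w =P v) => [->//|wv].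
  move=> /orP[/eqP ew|wn]; last by apply: hf; rewrite inE.
  by case: wv; apply: e_inj; rewrite ?inE // ev.
have [s Hs] := choice step.
pose F := fix F n := if n is m.+1 then s (m, F m) else (fun=> 0).
have PF n : P n (F n).
  elim: n => [|n IHn] /=; last by case: (Hs (n, F n) IHn).
  (* Since [below 0] is empty, [P 0] only asks that finite subsystems be solvable. *)
  move=> A; have [h hA] := laplacian_surj_finite A g.
  by exists h => // w; rewrite inE /below.
have F_stable n m v : (e v < n)%N -> F (n + m)%N v = F n v.
  move=> vn; elim: m => [|m IHm]; first by rewrite addn0.
  rewrite -IHm addnS /=; have [+ _] := Hs (_, F (n + m)%N) (PF _).
  by apply; rewrite inE /below /=; apply: leq_trans vn (leq_addr _ _).
(* The value at [v] is final from stage [(e v).+1] on. The bound [n] below exceeds the codes of [v]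
   and of all its neighbors, so [F n] already has the final values in the equation at [v]. *)
exists (fun v => F (e v).+1 v); apply/funext => v.
pose n := (e v + \sum_(w <- fset_set (neighbors G v)) e w).+1.
have [h hF hv] := PF n [fset v]%fset.
have hE w : (e w < n)%N -> F (e w).+1 w = h w.
  move=> wn; rewrite hF ?inE // -(subnKC wn).
  by rewrite F_stable.
rewrite -(hv v) ?inE //; apply: eq_laplacian => [|w].
  by apply: hE; rewrite ltnS leq_addr.
rewrite inE /= => vw; apply: hE; rewrite ltnS.
rewrite (big_rem w) ?mem_neighbors //= addnCA; exact: leq_addr.
Qed.

End Laplacian.

Theorem theorem1p1 (R : realType) (V : choiceType) (G : simplicial_graph V)
    (G_infinite : infinite_set [set: V])
    (G_connected : connected_graph G)
    (G_locally_finite : locally_finite G) :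
  set_surj [set: V -> R] [set: V -> R] (laplacian G).
Proof.
move=> g _; have [f fE] := laplacian_surj _ _ _ G_infinite G_connected G_locally_finite g.
by exists f.
Qed.
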